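(* In scheme (G) of the context choose $\bar\lambda_{k+1}=\lambda_k+\frac{\alpha_k}{\theta_k}(Av_{k+1}+Bw_k-b)$. Then (G) reduces to the following algorithm: $$\begin{cases}\widehat\lambda_k=\lambda_k-\theta_k^{-1}(Ax_k+By_k-b)+\frac{\alpha_k}{\theta_k}B(w_k-y_k),\\ x_{k+1}=\operatorname{argmin}_{x\in\mathcal X}\left\{\mathcal L_{\sigma_k}(x,y_k,\widehat\lambda_k)+\frac{\eta_{f,k}}{2\alpha_k^2}\|x-\widetilde x_k\|^2\right\},\quad\sigma_k=1/\theta_{k+1},\\ v_{k+1}=x_{k+1}+(x_{k+1}-x_k)/\alpha_k,\\ \bar\lambda_{k+1}=\lambda_k+\frac{\alpha_k}{\theta_k}(Av_{k+1}+Bw_k-b),\\ y_{k+1}=\operatorname{prox}^{\mathcal Y}_{\tau_kg}(\widetilde y_k-\tau_kB^\top\bar\lambda_{k+1}),\quad\tau_k=\alpha_k^2/\eta_{g,k},\\ w_{k+1}=y_{k+1}+(y_{k+1}-y_k)/\alpha_k,\\ \lambda_{k+1}=\lambda_k+\frac{\alpha_k}{\theta_k}(Av_{k+1}+Bw_{k+1}-b).\end{cases}$$ Assume $f\in\mathcal S^0_{\mu_f}(\mathcal X)$, $g\in\mathcal S^0_{\mu_g}(\mathcal Y)$ with $\mu_f,\mu_g\ge0$, that $\gamma_0=\mu_f$ if $\mu_f>0$ and $\beta_0=\mu_g$ if $\mu_g>0$, and that the step sizes satisfy $\alpha_k^2\|B\|^2=\theta_k\beta_k$ for all $k$. Then $\mathcal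 E_{k+1}-\mathcal E_k\le-\alpha_k\mathcal E_{k+1}$ for all $k$. Moreover, $\{(x_k,y_k)\}_{k\ge1}\subset\mathcal X\times\mathcal Y$ and $$\|Ax_k+By_k-b\|\le\theta_k\mathcal R_0,\qquad \mathcal L(x_k,y_k,\lambda^* )-\mathcal L(x^*,y^*,\lambda_k)\le\theta_k\mathcal E_0,\qquad |F(x_k,y_k)-F^*|\le\theta_k(\mathcal E_0+\|\lambda^*\|\mathcal R_0),$$ where $\mathcal R_0=\sqrt{2\mathcal E_0}+\|\lambda_0-\lambda^*\|+\|Ax_0+By_0-b\|$, and $$\theta_k\le\min\left\{\frac{Q}{Q+\sqrt{\beta_0}\,k},\ \frac{4Q^2}{(2Q+\sqrt{\mu_g}\,k)^2}\right\},\qquad Q=\|B\|+\sqrt{\beta_0}.$$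
   Context: Setting. $\mathcal X\subset\mathbb R^m$, $\mathcal Y\subset\mathbb R^n$ are closed convex sets, $A\in\mathbb R^{r\times m}$, $B\in\mathbb R^{r\times n}$, $b\in\mathbb R^r$, and $f:\mathbb R^m\to\mathbb R\cup\{+\infty\}$, $g:\mathbb R^n\to\mathbb R\cup\{+\infty\}$ are proper closed convex. The problem is to minimize $F(x,y)=f(x)+g(y)$ over $x\in\mathcal X,y\in\mathcal Y$ subject to $Ax+By=b$. $\mathcal L(x,y,\lambda)=F(x,y)+\delta_{\mathcal X\times\mathcal Y}(x,y)+\langle\lambda,Ax+By-b\rangle$ ($\delta$: indicator function) and $\mathcal L_\sigma(x,y,\lambda)=\mathcal L(x,y,\lambda)+\frac\sigma2\|Ax+By-b\|^2$. $(x^*,y^*,\lambda^* )\in\mathcal X\times\mathcal Y\times\mathbb R^r$ is a saddle point of $\mathcal L$ (assumed to exist): $\mathcal L(x^*,y^*,\lambda)\le\mathcal L(x^*,y^*,\lambda^* )\le\mathcal L(x,y,\lambda^* )$ for all $(x,y,\lambda)$; $F^*=F(x^*,y^* )$. Norms are Euclidean, and $\|A\|,\|B\|$ are the induced operator norms. $f\in\mathcal S^0_\mu(\mathcal X)$ means $f(x_1)-f(x_2)-\langle p,x_1-x_2\rangle\ge\frac\mu2\|x_1-x_2\|^2$ for all $x_1,x_2\in\mathcal X$, $p\in\partial f(x_2)$; $\mathcal S^0_\mu(\mathcal Y)$ is analogous. $\operatorname{prox}^{\mathcal Y}_{\tau g}(z)=\operatorname{argmin}_{y\in\mathcal Y}\{g(y)+\frac1{2\tau}\|y-z\|^2\}$.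 Parameters. $\theta_0=1$, $\gamma_0>0$, $\beta_0>0$, step sizes $\alpha_k>0$, and $$\frac{\theta_{k+1}-\theta_k}{\alpha_k}=-\theta_{k+1},\quad\frac{\gamma_{k+1}-\gamma_k}{\alpha_k}=\mu_f-\gamma_{k+1},\quad\frac{\beta_{k+1}-\beta_k}{\alpha_k}=\mu_g-\beta_{k+1}.$$ $\eta_{f,k}=(\alpha_k+1)\gamma_k+\mu_f\alpha_k$, $\eta_{g,k}=(\alpha_k+1)\beta_k+\mu_g\alpha_k$, $\widetilde x_k=x_k+\frac{\alpha_k\gamma_k}{\eta_{f,k}}(v_k-x_k)$, $\widetilde y_k=y_k+\frac{\alpha_k\beta_k}{\eta_{g,k}}(w_k-y_k)$. Scheme (G), from an initial guess $(x_0,v_0,y_0,w_0,\lambda_0)$; it is implicit, with the value $\bar\lambda_{k+1}$ (to be chosen) treated as a fixed vector inside the argmins: $$\begin{cases}v_{k+1}=x_{k+1}+(x_{k+1}-x_k)/\alpha_k,\\ x_{k+1}=\operatorname{argmin}_{x\in\mathcal X}\{\mathcal L(x,y_{k+1},\bar\lambda_{k+1})+\frac{\eta_{f,k}}{2\alpha_k^2}\|x-\widetilde x_k\|^2\},\\ \lambda_{k+1}=\lambda_k+\frac{\alpha_k}{\theta_k}(Av_{k+1}+Bw_{k+1}-b),\\ y_{k+1}=\operatorname{argmin}_{y\in\mathcal Y}\{\mathcal L(x_{k+1},y,\bar\lambda_{k+1})+\frac{\eta_{g,k}}{2\alpha_k^2}\|y-\widetilde y_k\|^2\},\\ w_{k+1}=y_{k+1}+(y_{k+1}-y_k)/\alpha_k.\end{cases}$$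 Discrete Lyapunov function: $\mathcal E_k=\mathcal L(x_k,y_k,\lambda^* )-\mathcal L(x^*,y^*,\lambda_k)+\frac{\gamma_k}2\|v_k-x^*\|^2+\frac{\beta_k}2\|w_k-y^*\|^2+\frac{\theta_k}2\|\lambda_k-\lambda^*\|^2$.
   Formalization: In S^0_mu(X) and S^0_mu(Y) the subgradients are those of f+delta_X and g+delta_Y (with those of f alone the claim fails if the sum rule fails, e.g. f=-sqrt(u_1), X={u_1=0}); the reduction of (G) to the algorithm assumes y_0 in Y and g(y_0) finite, so that the x_1-step makes sense. *)

(* Defs.v *)
From mathcomp Require Import all_boot all_order all_algebra.
From mathcomp Require Import all_classical all_reals all_analysis.

Set Implicit Arguments.
Unset Strict Implicit.
Unset Printing Implicit Defensive.

Import Order.TTheory GRing.Theory Num.Theory.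
Import numFieldNormedType.Exports.

Local Open Scope classical_set_scope.
Local Open Scope ring_scope.

(* The library norm on matrices is the sup norm; the Euclidean one is needed
   here. Both induce the same topology, so [closed] and
   [lower_semicontinuous] are the library notions. *)
Definition dot (R : realType) (n : nat) (u v : 'cV[R]_n) : R :=
  \sum_(i < n) u i 0 * v i 0.

Definition enorm (R : realType) (n : nat) (u : 'cV[R]_n) : R :=
  Num.sqrt (dot u u).

Definition opnorm (R : realType) (m n : nat) (M : 'M[R]_(m, n)) : R :=
  sup [set enorm (M *m u) | u in [set u : 'cV[R]_n | enorm u <= 1]].

(* A function into R U {+oo} is an extended-real function avoiding -oo. *)
Definition proper_efun (R : realType) (T : Type) (h : T -> \bar R) : Prop :=
  (forall x, h x != -oo%E) /\ (exists x, (h x < +oo)%E).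

Definition convex_efun (R : realType) (n : nat) (h : 'cV[R]_n -> \bar R) :
    Prop :=
  forall (x y : 'cV[R]_n) (t : R), 0 < t < 1 ->
    (h (t *: x + (1 - t) *: y)%R <= t%:E * h x + (1 - t)%:E * h y)%E.

Definition proper_closed_convex (R : realType) (n : nat)
    (h : 'cV[R]_n -> \bar R) : Prop :=
  [/\ proper_efun h, lower_semicontinuous h & convex_efun h].

Definition delta_fun (R : realType) (T : Type) (C : set T) (x : T) : \bar R :=
  if `[< C x >] then 0%E else +oo%E.

Definition subdiff (R : realType) (n : nat) (h : 'cV[R]_n -> \bar R)
    (x : 'cV[R]_n) : set 'cV[R]_n :=
  [set p | h x \is a fin_num /\
           forall z : 'cV[R]_n, (h x + (dot p (z - x)%R)%:E <= h z)%E].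

(* The class S^0_mu(C). The subgradients are those of h regarded as a function
   on C, i.e. of h + delta_fun C; they contain the subgradients of h at points of
   C. If the sum rule [subdiff (h + delta_fun C) = subdiff h + normal cone of C]
   holds, or if mu = 0, using those of h alone gives the same class; without
   the sum rule it need not: h(u) = - sqrt u_1 on {u_1 >= 0} has no subgradient
   at all on C = {u_1 = 0}, where it is constant. *)
Definition strongly_convex_on (R : realType) (n : nat) (mu : R)
    (C : set 'cV[R]_n) (h : 'cV[R]_n -> \bar R) : Prop :=
  forall x1 x2 p : 'cV[R]_n, C x1 -> C x2 ->
    subdiff (fun x => h x + delta_fun R C x)%E x2 p ->
    ((mu / 2 * enorm (x1 - x2) ^+ 2)%:E
      <= h x1 - h x2 - (dot p (x1 - x2)%R)%:E)%E.

(* As usual, an objective that is identically +oo on C has no minimizer. *)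
Definition is_argmin (R : realType) (T : Type) (C : set T) (h : T -> \bar R)
    (x : T) : Prop :=
  [/\ C x, (h x < +oo)%E & forall z, C z -> (h x <= h z)%E].

Definition is_prox (R : realType) (n : nat) (C : set 'cV[R]_n) (tau : R)
    (h : 'cV[R]_n -> \bar R) (z y : 'cV[R]_n) : Prop :=
  is_argmin C (fun u => h u + (1 / (2 * tau) * enorm (u - z)%R ^+ 2)%:E)%E y.

Record problem (R : realType) (m n r : nat) := Problem {
  csetX : set 'cV[R]_m;
  csetY : set 'cV[R]_n;
  matA : 'M[R]_(r, m);
  matB : 'M[R]_(r, n);
  vecb : 'cV[R]_r;
  objf : 'cV[R]_m -> \bar R;
  objg : 'cV[R]_n -> \bar R
}.

Definition objective (R : realType) (m n r : nat) (P : problem R m n r)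
    (x : 'cV[R]_m) (y : 'cV[R]_n) : \bar R :=
  (objf P x + objg P y)%E.

Definition residual (R : realType) (m n r : nat) (P : problem R m n r)
    (x : 'cV[R]_m) (y : 'cV[R]_n) : 'cV[R]_r :=
  matA P *m x + matB P *m y - vecb P.

Definition lagrangian (R : realType) (m n r : nat) (P : problem R m n r)
    (x : 'cV[R]_m) (y : 'cV[R]_n) (l : 'cV[R]_r) : \bar R :=
  (objective P x y + delta_fun R (csetX P `*` csetY P) (x, y)
    + (dot l (residual P x y))%:E)%E.

Definition aug_lagrangian (R : realType) (m n r : nat) (P : problem R m n r)
    (sigma : R) (x : 'cV[R]_m) (y : 'cV[R]_n) (l : 'cV[R]_r) : \bar R :=
  (lagrangian P x y l + (sigma / 2 * enorm (residual P x y) ^+ 2)%:E)%E.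

(* The saddle value is required to be finite: it is +oo only if no point of
   X x Y has a finite objective, and then every point of X x Y would qualify. *)
Definition is_saddle (R : realType) (m n r : nat) (P : problem R m n r)
    (xs : 'cV[R]_m) (ys : 'cV[R]_n) (ls : 'cV[R]_r) : Prop :=
  [/\ csetX P xs, csetY P ys, lagrangian P xs ys ls \is a fin_num &
      forall (x : 'cV[R]_m) (y : 'cV[R]_n) (l : 'cV[R]_r),
        (lagrangian P xs ys l <= lagrangian P xs ys ls)%E /\
        (lagrangian P xs ys ls <= lagrangian P x y ls)%E].

Record parameters (R : realType) := Params {
  mu_f : R;
  mu_g : R;
  theta : nat -> R;
  gamma : nat -> R;
  beta : nat -> R;
  alpha : nat -> R
}.

Definition valid_parameters (R : realType) (q : parameters R) : Prop :=
  [/\ theta q 0 = 1, 0 < gamma q 0, 0 < beta q 0,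
      forall k, 0 < alpha q k &
      forall k,
        [/\ (theta q k.+1 - theta q k) / alpha q k = - theta q k.+1,
            (gamma q k.+1 - gamma q k) / alpha q k = mu_f q - gamma q k.+1 &
            (beta q k.+1 - beta q k) / alpha q k = mu_g q - beta q k.+1]].

Definition eta_f (R : realType) (q : parameters R) (k : nat) : R :=
  (alpha q k + 1) * gamma q k + mu_f q * alpha q k.

Definition eta_g (R : realType) (q : parameters R) (k : nat) : R :=
  (alpha q k + 1) * beta q k + mu_g q * alpha q k.

(* The value [lbar s 0] is never used. *)
Record iterates (R : realType) (m n r : nat) := Iterates {
  xk : nat -> 'cV[R]_m;
  vk : nat -> 'cV[R]_m;
  yk : nat -> 'cV[R]_n;
  wk : nat -> 'cV[R]_n;
  lam : nat -> 'cV[R]_r;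
  lbar : nat -> 'cV[R]_r
}.

Definition xtilde (R : realType) (m n r : nat) (q : parameters R)
    (s : iterates R m n r) (k : nat) : 'cV[R]_m :=
  xk s k + (alpha q k * gamma q k / eta_f q k) *: (vk s k - xk s k).

Definition ytilde (R : realType) (m n r : nat) (q : parameters R)
    (s : iterates R m n r) (k : nat) : 'cV[R]_n :=
  yk s k + (alpha q k * beta q k / eta_g q k) *: (wk s k - yk s k).

Definition scheme_G (R : realType) (m n r : nat) (P : problem R m n r)
    (q : parameters R) (s : iterates R m n r) : Prop :=
  forall k,
    [/\ vk s k.+1 = xk s k.+1 + (alpha q k)^-1 *: (xk s k.+1 - xk s k),
        is_argmin (csetX P)
          (fun x => lagrangian P x (yk s k.+1) (lbar s k.+1)
             + (eta_f q k / (2 * alpha q k ^+ 2)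
                  * enorm (x - xtilde q s k)%R ^+ 2)%:E)%E
          (xk s k.+1),
        lam s k.+1 = lam s k
          + (alpha q k / theta q k) *: residual P (vk s k.+1) (wk s k.+1),
        is_argmin (csetY P)
          (fun y => lagrangian P (xk s k.+1) y (lbar s k.+1)
             + (eta_g q k / (2 * alpha q k ^+ 2)
                  * enorm (y - ytilde q s k)%R ^+ 2)%:E)%E
          (yk s k.+1) &
        wk s k.+1 = yk s k.+1 + (alpha q k)^-1 *: (yk s k.+1 - yk s k)].

Definition lbar_choice (R : realType) (m n r : nat) (P : problem R m n r)
    (q : parameters R) (s : iterates R m n r) : Prop :=
  forall k, lbar s k.+1 = lam s k
    + (alpha q k / theta q k) *: residual P (vk s k.+1) (wk s k).

Definition lhat (R : realType) (m n r : nat) (P : problem R m n r)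
    (q : parameters R) (s : iterates R m n r) (k : nat) : 'cV[R]_r :=
  lam s k - (theta q k)^-1 *: residual P (xk s k) (yk s k)
    + (alpha q k / theta q k) *: (matB P *m (wk s k - yk s k)).

Definition algorithm (R : realType) (m n r : nat) (P : problem R m n r)
    (q : parameters R) (s : iterates R m n r) : Prop :=
  forall k,
    let sigma := 1 / theta q k.+1 in
    let tau := alpha q k ^+ 2 / eta_g q k in
    is_argmin (csetX P)
      (fun x => aug_lagrangian P sigma x (yk s k) (lhat P q s k)
         + (eta_f q k / (2 * alpha q k ^+ 2)
              * enorm (x - xtilde q s k)%R ^+ 2)%:E)%E
      (xk s k.+1)
    /\ vk s k.+1 = xk s k.+1 + (alpha q k)^-1 *: (xk s k.+1 - xk s k)
    /\ lbar s k.+1 = lam s k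
         + (alpha q k / theta q k) *: residual P (vk s k.+1) (wk s k)
    /\ is_prox (csetY P) tau (objg P)
         (ytilde q s k - tau *: ((matB P)^T *m lbar s k.+1)) (yk s k.+1)
    /\ wk s k.+1 = yk s k.+1 + (alpha q k)^-1 *: (yk s k.+1 - yk s k)
    /\ lam s k.+1 = lam s k
         + (alpha q k / theta q k) *: residual P (vk s k.+1) (wk s k.+1).

(* Both quantities below are +oo when (x_0, y_0) lies outside X x Y or the
   objective is infinite there; [lyapunov] is finite for k > 0. *)
Definition lyapunov (R : realType) (m n r : nat) (P : problem R m n r)
    (q : parameters R) (s : iterates R m n r)
    (xs : 'cV[R]_m) (ys : 'cV[R]_n) (ls : 'cV[R]_r) (k : nat) : \bar R :=
  (lagrangian P (xk s k) (yk s k) ls - lagrangian P xs ys (lam s k)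
    + (gamma q k / 2 * enorm (vk s k - xs)%R ^+ 2)%:E
    + (beta q k / 2 * enorm (wk s k - ys)%R ^+ 2)%:E
    + (theta q k / 2 * enorm (lam s k - ls)%R ^+ 2)%:E)%E.

Definition calR0 (R : realType) (m n r : nat) (P : problem R m n r)
    (q : parameters R) (s : iterates R m n r)
    (xs : 'cV[R]_m) (ys : 'cV[R]_n) (ls : 'cV[R]_r) : \bar R :=
  (sqrte (2%:E * lyapunov P q s xs ys ls 0)
    + (enorm (lam s 0 - ls)%R)%:E
    + (enorm (residual P (xk s 0) (yk s 0)))%:E)%E.

(* Main.v *)
Require Import Defs.
From mathcomp Require Import all_boot all_order all_algebra.
From mathcomp Require Import all_classical all_reals all_analysis.
From mathcomp Require Import ring lra.

Import Order.TTheory GRing.Theory Num.Theory.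
Import numFieldNormedType.Exports.

Local Open Scope classical_set_scope.
Local Open Scope ring_scope.

(* Minimizing a convex function plus a convex quadratic over a convex set is
   equivalent to a variational inequality involving only the gradient of the
   quadratic at the minimizer. With the chosen multiplier one has
   lbar_{k+1} = lhat_k + (A x_{k+1} + B y_k - b) / theta_{k+1}, so that the
   implicit scheme and the explicit algorithm have the same variational
   inequalities.

   The same inequalities provide subgradients at x_{k+1} and y_{k+1}. Testing
   them at the saddle point and at the previous iterate, strong convexity gives
   (1 + alpha_k) E_{k+1} <= E_k up to the cross term
   alpha_k <A v_{k+1} + B w_{k+1} - b, lambda_{k+1} - lbar_{k+1}>, which
   alpha_k^2 |B|^2 = theta_k beta_k makes absorbable. Hence
   E_k <= theta_k E_0. Since lambda_k - r_k / theta_k is constant, r_k being the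
   residual A x_k + B y_k - b, the bound on the multipliers contained in E_k
   yields the one on the residuals. *)

(** * Euclidean inner product and norm *)

Lemma dotC {R : realType} {n} (u v : 'cV[R]_n) : dot u v = dot v u.
Proof. by apply: eq_bigr => i _; rewrite mulrC. Qed.

Lemma dotDr {R : realType} {n} (u v w : 'cV[R]_n) :
  dot u (v + w) = dot u v + dot u w.
Proof. by rewrite -big_split; apply: eq_bigr => i _; rewrite mxE mulrDr. Qed.

Lemma dotZr {R : realType} {n} (c : R) (u v : 'cV[R]_n) :
  dot u (c *: v) = c * dot u v.
Proof. by rewrite mulr_sumr; apply: eq_bigr => i _; rewrite mxE mulrCA. Qed.

Lemma dotNr {R : realType} {n} (u v : 'cV[R]_n) : dot u (- v) = - dot u v.
Proof. by rewrite -scaleN1r dotZr mulN1r. Qed.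

Lemma dotDl {R : realType} {n} (u v w : 'cV[R]_n) :
  dot (v + w) u = dot v u + dot w u.
Proof. by rewrite dotC dotDr !(dotC u). Qed.

Lemma dotZl {R : realType} {n} (c : R) (u v : 'cV[R]_n) :
  dot (c *: v) u = c * dot v u.
Proof. by rewrite dotC dotZr dotC. Qed.

Lemma dotNl {R : realType} {n} (u v : 'cV[R]_n) : dot (- v) u = - dot v u.
Proof. by rewrite dotC dotNr dotC. Qed.

Definition dotE {R : realType} :=
  (@dotDl R, @dotDr R, @dotNl R, @dotNr R, @dotZl R, @dotZr R).

Lemma dot0r {R : realType} {n} (u : 'cV[R]_n) : dot u 0 = 0.
Proof. by rewrite -(scale0r 0) dotZr mul0r. Qed.

Lemma dot_ge0 {R : realType} {n} (u : 'cV[R]_n) : 0 <= dot u u.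
Proof. by apply: sumr_ge0 => i _; rewrite -expr2 sqr_ge0. Qed.

Lemma dot_eq0 {R : realType} {n} (u : 'cV[R]_n) : dot u u = 0 -> u = 0.
Proof.
move=> /eqP; rewrite psumr_eq0 => [|i _]; last by rewrite -expr2 sqr_ge0.
move=> /allP u0; apply/colP => i; rewrite mxE.
by apply/eqP; have := u0 i (mem_index_enum i); rewrite /= mulf_eq0 orbb.
Qed.

Lemma dot_mulmx {R : realType} {m n} (M : 'M[R]_(m, n)) u v :
  dot u (M *m v) = dot (M^T *m u) v.
Proof.
have dotM k (a b : 'cV[R]_k) : dot a b = (a^T *m b) 0 0.
  by rewrite mxE; apply: eq_bigr => i _; rewrite mxE.
by rewrite !dotM trmx_mul trmxK mulmxA.
Qed.

Lemma enorm_sqr {R : realType} {n} (u : 'cV[R]_n) : enorm u ^+ 2 = dot u u.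
Proof. by rewrite sqr_sqrtr // dot_ge0. Qed.

Lemma enorm_ge0 {R : realType} {n} (u : 'cV[R]_n) : 0 <= enorm u.
Proof. exact: sqrtr_ge0. Qed.

Lemma enorm_le {R : realType} {n} (u : 'cV[R]_n) (c : R) :
  0 <= c -> (enorm u <= c) = (dot u u <= c ^+ 2).
Proof. by move=> c0; rewrite -enorm_sqr ler_pXn2r // nnegrE enorm_ge0. Qed.

Lemma enormZ {R : realType} {n} (c : R) (u : 'cV[R]_n) :
  enorm (c *: u) = `|c| * enorm u.
Proof.
by rewrite /enorm dotZl dotZr mulrA -expr2 sqrtrM ?sqr_ge0 // sqrtr_sqr.
Qed.

Lemma enormN {R : realType} {n} (u : 'cV[R]_n) : enorm (- u) = enorm u.
Proof. by rewrite /enorm dotNl dotNr opprK. Qed.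

(** Cauchy-Schwarz: the squared length of [dot v v *: u - dot u v *: v] is [dot v v] times the
    defect of the squared inequality. *)
Lemma dot_le {R : realType} {n} (u v : 'cV[R]_n) :
  dot u v <= enorm u * enorm v.
Proof.
have [->|v0] := eqVneq v 0; first by rewrite dot0r mulr_ge0 ?enorm_ge0.
have vv : 0 < dot v v.
  rewrite lt_def dot_ge0 andbT; apply: contra_neq v0; exact: dot_eq0.
apply: le_trans (ler_norm _) _.
rewrite -(@ler_pXn2r _ 2) ?nnegrE ?mulr_ge0 ?enorm_ge0 ?normr_ge0 //.
rewrite real_normK ?num_real // exprMn !enorm_sqr.
have := dot_ge0 (dot v v *: u - dot u v *: v).
rewrite !dotE (dotC v u) => h.
rewrite -subr_ge0 -(pmulr_rge0 _ vv); apply: le_trans h _; lra.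
Qed.

Lemma normr_dot_le {R : realType} {n} (u v : 'cV[R]_n) :
  `|dot u v| <= enorm u * enorm v.
Proof. by rewrite ler_norml lerNl -dotNl -{1}enormN !dot_le. Qed.

Lemma enormD {R : realType} {n} (u v : 'cV[R]_n) :
  enorm (u + v) <= enorm u + enorm v.
Proof.
rewrite enorm_le ?addr_ge0 ?enorm_ge0 // !dotE (dotC v u).
rewrite sqrrD !enorm_sqr; have := dot_le u v; lra.
Qed.

(** * Operator norm *)

Lemma has_sup_opnorm {R : realType} {m n} (M : 'M[R]_(m, n)) :
  has_sup [set enorm (M *m u) | u in [set u : 'cV[R]_n | enorm u <= 1]].
Proof.
split.
  exists (enorm (M *m 0)), 0 => //=.
  by rewrite /enorm dot0r sqrtr0.
(* The Frobenius norm is an upper bound, by Cauchy-Schwarz in each row. *)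
exists (Num.sqrt (\sum_i dot (row i M)^T (row i M)^T)) => _ [u u1 <-].
rewrite ler_sqrt; last by apply: sumr_ge0 => i _; exact: dot_ge0.
apply: ler_sum => i _.
have -> : (M *m u) i 0 = dot (row i M)^T u.
  by rewrite mxE; apply: eq_bigr => j _; rewrite !mxE.
rewrite -expr2 -real_normK ?num_real // -enorm_sqr.
rewrite ler_pXn2r ?nnegrE ?enorm_ge0 //.
by apply: le_trans (normr_dot_le _ _) _; rewrite ler_piMr ?enorm_ge0.
Qed.

Lemma opnorm_ge0 {R : realType} {m n} (M : 'M[R]_(m, n)) : 0 <= opnorm M.
Proof.
apply: le_trans (enorm_ge0 (M *m 0)) _.
apply: sup_upper_bound (has_sup_opnorm M) _ _; exists 0 => //=.
by rewrite /enorm dot0r sqrtr0.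
Qed.

Lemma enorm_mulmx_le {R : realType} {m n} (M : 'M[R]_(m, n)) u :
  enorm (M *m u) <= opnorm M * enorm u.
Proof.
have [->|u0] := eqVneq u 0; first by rewrite mulmx0 /enorm !dot0r sqrtr0 mulr0.
have uu : 0 < enorm u.
  rewrite lt_def enorm_ge0 andbT; apply: contra_neq u0 => u0.
  by apply: dot_eq0; rewrite -enorm_sqr u0 expr0n.
rewrite -ler_pdivrMr //.
apply: sup_upper_bound (has_sup_opnorm M) _ _; exists ((enorm u)^-1 *: u) => /=.
  by rewrite enormZ ger0_norm ?invr_ge0 ?enorm_ge0 // mulVf // gt_eqF.
by rewrite -scalemxAr enormZ ger0_norm ?invr_ge0 ?enorm_ge0 // mulrC.
Qed.

(** * Optimality conditions as variational inequalities *)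

Lemma convex_set_comb {R : realType} {n} (C : set 'cV[R]_n) (t : R) x z :
  convex_set C -> 0 < t < 1 -> C z -> C x -> C (t *: z + (1 - t) *: x).
Proof.
move=> cC /andP[t0 t1] Cz Cx.
have t01 : Itv.spec (@Itv.num_sem R) (Itv.Real `[0%Z, 1%Z]) t.
  by rewrite /= /Itv.num_sem num_real /= in_itv /= !ltW.
have := cC z x (Itv.Def t01); rewrite !inE; exact.
Qed.

(* Moving from the minimizer [x] towards [z] by a factor [t], the second order
   part of [phi] contributes [t ^+ 2 * kappa (z - x)], negligible against the
   linear terms. *)
Lemma is_argmin_quadratic {R : realType} {n} (h : 'cV[R]_n -> \bar R)
    (C : set 'cV[R]_n) (phi kappa : 'cV[R]_n -> R) (g x : 'cV[R]_n) :
  (forall z, h z != -oo%E) -> convex_efun h -> convex_set C ->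
  (forall z, phi z = phi x + dot g (z - x) + kappa (z - x)) ->
  (forall t d, kappa (t *: d) = t ^+ 2 * kappa d) ->
  (forall d, 0 <= kappa d) ->
  is_argmin C (fun z => h z + (phi z)%:E)%E x <->
  [/\ C x, (h x < +oo)%E &
      forall z, C z -> (h x <= h z + (dot g (z - x))%:E)%E].
Proof.
move=> hN ch cC phiE kappaZ kappa_ge0.
have hx_fin a : h x = a -> (a < +oo)%E -> exists b, h x = b%:E.
  by move: (hN x) => + ha; rewrite ha; case: a {ha} => // b; exists b.
split; last first.
  move=> [Cx hx xmin]; split => //; first by rewrite lte_add_pinfty ?ltry.
  move=> z Cz; have := xmin z Cz; have := hN z; rewrite (phiE z).
  have [a ->] := hx_fin _ erefl hx.
  case: (h z) => [b| |] // _; last by move=> _; exact: leey.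
  by rewrite -!EFinD !lee_fin; have := kappa_ge0 (z - x); lra.
move=> [Cx hx xmin].
have {}hx : (h x < +oo)%E.
  by move: hx (hN x); case: (h x) => // b _ _; exact: ltry.
split=> // z Cz.
have [a ha] := hx_fin _ erefl hx.
have := hN z; case hz: (h z) => [b| |] // _; last exact: leey.
rewrite ha -EFinD lee_fin.
(* Convexity of [h] along the segment bounds its increment; dividing by [t] leaves [kappa] with a
   factor [t]. *)
have {}xmin t : 0 < t < 1 -> 0 <= b - a + dot g (z - x) + t * kappa (z - x).
  move=> t01; have /andP[t0 t1] := t01.
  have := xmin _ (convex_set_comb C t _ _ cC t01 Cz Cx).
  have := ch z x t t01; have := hN (t *: z + (1 - t) *: x).
  rewrite (phiE (_ + _)) ha hz -!EFinM -EFinD.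
  have -> : t *: z + (1 - t) *: x - x = t *: (z - x).
    by apply/colP => i; rewrite !mxE; ring.
  rewrite kappaZ dotZr; case: (h _) => [c||] // _.
  rewrite -!EFinD !lee_fin => h1 h2.
  by rewrite -(pmulr_rge0 _ t0); lra.
rewrite -subr_ge0 leNgt; apply/negP => D0.
set D := b + _ - a in D0; have k0 := kappa_ge0 (z - x).
have kD : 0 < kappa (z - x) + 1 - D by lra.
(* For [D < 0] this [t] lies in (0, 1), and [D + t * kappa (z - x)] becomes [D * (1 - D)] over the
   same denominator, which is negative. *)
have := xmin (- D / (kappa (z - x) + 1 - D)).
rewrite ltr_pdivrMr // divr_gt0 ?oppr_gt0 // mul1r.
have -> : - D < kappa (z - x) + 1 - D by lra.
move=> /(_ isT); apply/negP; rewrite -ltNge.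
have -> : b - a + dot g (z - x) = D by rewrite /D; ring.
have -> : D + - D / (kappa (z - x) + 1 - D) * kappa (z - x)
    = D * ((1 - D) / (kappa (z - x) + 1 - D)) by field; rewrite gt_eqF.
by rewrite pmulr_llt0 // divr_gt0 //; lra.
Qed.

(** * One-step decrease of the energy *)

(* One primal block: [p] is the subgradient at [x] given by the optimality
   condition, tested at the solution [z] and at the previous iterate [xo]. As
   [(1 + al) x - xo = al v], the two tests combine into [al <p, v - z>]. *)
Lemma block_descent {R : realType} {n} (xo x vo v z c : 'cV[R]_n)
    (fo f fz al ga mu : R) :
  0 < al -> 0 <= mu ->
  v = x + al^-1 *: (x - xo) ->
  let p := - c - (ga / al) *: (v - vo) - mu *: (v - x) in
  mu / 2 * dot (z - x) (z - x) <= fz - f - dot p (z - x) ->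
  0 <= fo - f - dot p (xo - x) ->
  (1 + al) * f - fo - al * fz + (ga + al * mu) / 2 * dot (v - z) (v - z)
    - ga / 2 * dot (vo - z) (vo - z)
  <= - (al * dot c (v - z)) - ga / 2 * dot (v - vo) (v - vo).
Proof.
move=> al0 mu0 vE p.
have xoE : xo - x = - al *: (v - x).
  by rewrite vE [x + _]addrC addrK scalerA mulNr mulfV ?gt_eqF // scaleN1r opprB.
have zE : z - x = (v - x) - (v - z).
  by apply/colP => i; rewrite !mxE; ring.
have voE : vo - z = (v - z) - (v - vo).
  by apply/colP => i; rewrite !mxE; ring.
rewrite xoE zE voE /p.
move: (v - x) (v - z) (v - vo) => e a d.
rewrite !dotE (dotC d a) (dotC d e) (dotC e a) => h1 h2.
(* Strong convexity and the [mu] part of [p] combine into [- al * mu / 2] times [dot e e + dot a a].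
   The [a] part pays for the growth of [ga]; the [e] part is dropped. *)
have h3 : 0 <= al * mu * dot e e by rewrite !mulr_ge0 ?dot_ge0 // ltW.
have h4 := ler_wpM2l (ltW al0) h1.
have gaE : ga = al * (ga / al) by rewrite mulrCA mulfV ?mulr1 ?gt_eqF.
by move: (ga / al) gaE h2 h4 => k ->; lra.
Qed.

(** The updates give [al *: v = (1 + al) *: x - xo], likewise for [w], and the multiples of [b]
    match since [(1 + al) - 1 = al]. This links the dual update, driven by [v] and [w], to the
    residuals of the primal iterates. *)
Lemma residual_step {R : realType} {m n r} (A : 'M[R]_(r, m))
    (B : 'M[R]_(r, n)) (b : 'cV[R]_r) (al : R) (xo x v : 'cV[R]_m)
    (yo y w : 'cV[R]_n) :
  al == 0 = false ->
  v = x + al^-1 *: (x - xo) -> w = y + al^-1 *: (y - yo) ->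
  (1 + al) *: (A *m x + B *m y - b) - (A *m xo + B *m yo - b)
    = al *: (A *m v + B *m w - b).
Proof.
move=> al0 vE wE.
have velE k (z z' zo : 'cV[R]_k) : z' = z + al^-1 *: (z - zo) ->
    al *: z' = (1 + al) *: z - zo.
  move=> ->; rewrite scalerDr scalerA mulfV ?al0 // scale1r.
  by rewrite scalerDl scale1r addrCA addrA.
rewrite [RHS]scalerBr [in RHS]scalerDr !scalemxAr.
rewrite (velE _ _ _ _ vE) (velE _ _ _ _ wE).
rewrite !mulmxBr -!scalemxAr.
by apply/colP => i; rewrite !mxE; ring.
Qed.

(* Summing the two blocks and the dual update leaves [al <R, l - lb>], with [R]
   the residual at [(v, w)], minus squares. Here
   [l - lb = (al / th) B (w - wo)], and the step size condition is exactly what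
   lets the squares absorb this cross term. *)
Lemma lyapunov_step {R : realType} {m n r} (A : 'M[R]_(r, m)) (B : 'M[R]_(r, n))
    (b lo l lb ls : 'cV[R]_r) (xo x vo v xs : 'cV[R]_m)
    (yo y wo w ys : 'cV[R]_n) (fo f fs go g gs al th ga be muf mug : R) :
  let res x y := A *m x + B *m y - b in
  0 < al -> 0 < th -> 0 < ga -> 0 <= muf -> 0 <= mug ->
  al ^+ 2 * opnorm B ^+ 2 = th * be ->
  res xs ys = 0 ->
  v = x + al^-1 *: (x - xo) -> w = y + al^-1 *: (y - yo) ->
  l = lo + (al / th) *: res v w -> lb = lo + (al / th) *: res v wo ->
  let p := - (A^T *m lb) - (ga / al) *: (v - vo) - muf *: (v - x) in
  let p' := - (B^T *m lb) - (be / al) *: (w - wo) - mug *: (w - y) in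
  muf / 2 * dot (xs - x) (xs - x) <= fs - f - dot p (xs - x) ->
  0 <= fo - f - dot p (xo - x) ->
  mug / 2 * dot (ys - y) (ys - y) <= gs - g - dot p' (ys - y) ->
  0 <= go - g - dot p' (yo - y) ->
  (1 + al) * (f + g - (fs + gs) + dot ls (res x y))
    + (ga + al * muf) / 2 * dot (v - xs) (v - xs)
    + (be + al * mug) / 2 * dot (w - ys) (w - ys)
    + th / 2 * dot (l - ls) (l - ls)
  <= fo + go - (fs + gs) + dot ls (res xo yo)
    + ga / 2 * dot (vo - xs) (vo - xs)
    + be / 2 * dot (wo - ys) (wo - ys)
    + th / 2 * dot (lo - ls) (lo - ls).
Proof.
move=> res al0 th0 ga0 muf0 mug0 alB res0 vE wE lE lbE p p' hf1 hf0 hg1 hg0.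
have := block_descent _ _ _ _ _ _ _ _ _ _ _ _ al0 muf0 vE hf1 hf0.
have := block_descent _ _ _ _ _ _ _ _ _ _ _ _ al0 mug0 wE hg1 hg0.
rewrite -!dot_mulmx => hg hf.
(* Feasibility of [(xs, ys)] merges the linear terms of the two blocks. *)
have resE : A *m (v - xs) + B *m (w - ys) = res v w.
  rewrite -[RHS]subr0 -res0 /res !mulmxBr.
  by apply/colP => i; rewrite !mxE; ring.
have {}resE : dot lb (A *m (v - xs)) + dot lb (B *m (w - ys)) = dot lb (res v w).
  by rewrite -dotDr resE.
have stepE := residual_step A B b al _ _ _ _ _ _ (gt_eqF al0) vE wE.
have {}stepE : (1 + al) * dot ls (res x y) - dot ls (res xo yo)
    = al * dot ls (res v w).
  by rewrite -!dotZr -stepE (dotDr _ (_ *: _)) dotNr.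
have gaw : 0 <= ga * dot (v - vo) (v - vo) by rewrite mulr_ge0 ?dot_ge0 // ltW.
set u := res v w in lE resE stepE.
set e := B *m (w - wo).
have lbE' : lb = lo + (al / th) *: (u - e).
  by rewrite lbE /u /e /res mulmxBr; congr (_ + _ *: _);
    apply/colP => i; rewrite !mxE; ring.
have he : al ^+ 2 * dot e e <= th * be * dot (w - wo) (w - wo).
  rewrite -alB -mulrA ler_pM2l ?exprn_gt0 // -!enorm_sqr -exprMn.
  by rewrite ler_pXn2r ?nnegrE ?mulr_ge0 ?enorm_ge0 ?opnorm_ge0 ?enorm_mulmx_le.
(* Young's inequality for [dot e u]. With [t = al / th], the dual update and the linear terms leave
   [th * t ^+ 2 * (dot e u - dot u u / 2)], at most [th * t ^+ 2 / 2 * dot e e]; by [he] the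
   negative square in [w - wo] from the second block absorbs this. *)
have hue := dot_ge0 (u - e).
clear lbE wE vE res0 hf1 hf0 hg1 hg0; clearbody u e; clearbody res.
have lls : l - ls = (lo - ls) + (al / th) *: u by rewrite lE addrAC.
rewrite {}lls.
have : dot lb u = dot ls u + dot (lo - ls) u + al / th * (dot u u - dot e u).
  by rewrite lbE' !dotE; ring.
move: (lo - ls) => q.
move: hue; rewrite !dotE (dotC u e) => hue lbu.
have thE : al = th * (al / th) by rewrite mulrCA mulfV ?mulr1 ?gt_eqF.
have t0 : 0 < al / th by rewrite divr_gt0.
set t := al / th in lbu thE t0 *.
have {}he : th * (t ^+ 2 * dot e e) <= be * dot (w - wo) (w - wo).
  rewrite -(ler_pM2l th0); apply: le_trans (_ : _ <= al ^+ 2 * dot e e) _.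
    by rewrite thE le_eqVlt; apply/orP; left; apply/eqP; ring.
  by apply: le_trans he _; rewrite mulrA.
have {}hue := mulr_ge0 (mulr_ge0 (ltW th0) (sqr_ge0 t)) hue.
clear p p' alB lE lbE'; clearbody t; subst al.
have := congr1 (fun z => th * t * z) lbu.
have := congr1 (fun z => th * t * z) resE.
move: hf hg stepE gaw he hue; rewrite /= !dotE (dotC u q) => *.
lra.
Qed.

(** * Parameter sequences and the decay of [theta] *)

Lemma valid_parameters_rec {R : realType} (q : parameters R) :
  valid_parameters q -> forall k,
  [/\ theta q k = (1 + alpha q k) * theta q k.+1,
      (1 + alpha q k) * gamma q k.+1 = gamma q k + alpha q k * mu_f q &
      (1 + alpha q k) * beta q k.+1 = beta q k + alpha q k * mu_g q].
Proof.
move=> [_ _ _ al0 rec] k; have [h1 h2 h3] := rec k.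
have mul_al (z z' c : R) : (z' - z) / alpha q k = c -> z' - z = alpha q k * c.
  by move=> <-; rewrite mulrCA mulfV ?mulr1 // gt_eqF.
by split; [move: h1 | move: h2 | move: h3] => /mul_al; lra.
Qed.

Lemma theta_gt0 {R : realType} (q : parameters R) :
  valid_parameters q -> forall k, 0 < theta q k.
Proof.
move=> vq; have [th0 _ _ al0 _] := vq; elim=> [|k IH]; first by rewrite th0.
have [thE _ _] := valid_parameters_rec q vq k.
by move: IH; rewrite thE pmulr_rgt0 // addr_gt0.
Qed.

Lemma gamma_gt0 {R : realType} (q : parameters R) :
  valid_parameters q -> 0 <= mu_f q -> forall k, 0 < gamma q k.
Proof.
move=> vq mu0; have [_ ga0 _ al0 _] := vq; elim=> [//|k IH].
have [_ gaE _] := valid_parameters_rec q vq k.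
rewrite -(@pmulr_rgt0 _ (1 + alpha q k)) ?addr_gt0 // gaE.
by rewrite ltr_wpDr // mulr_ge0 // ltW.
Qed.

Lemma beta_gt0 {R : realType} (q : parameters R) :
  valid_parameters q -> 0 <= mu_g q -> forall k, 0 < beta q k.
Proof.
move=> vq mu0; have [_ _ be0 al0 _] := vq; elim=> [//|k IH].
have [_ _ beE] := valid_parameters_rec q vq k.
rewrite -(@pmulr_rgt0 _ (1 + alpha q k)) ?addr_gt0 // beE.
by rewrite ltr_wpDr // mulr_ge0 // ltW.
Qed.

(* [1 / theta] grows by [alpha / theta] at each step, which is at least
   [sqrt (beta 0) / L] because [beta k >= beta 0 * theta k]. *)
Lemma theta_le_linear {R : realType} (q : parameters R) (L : R) :
  valid_parameters q -> 0 <= mu_g q -> 0 <= L ->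
  (forall k, alpha q k ^+ 2 * L ^+ 2 = theta q k * beta q k) ->
  forall k, theta q k * (L + Num.sqrt (beta q 0) * k%:R) <= L.
Proof.
move=> vq mu0 L0 alL; have [th0 _ be0 al0 _] := vq.
have thpos := theta_gt0 q vq.
(* [beta / theta] is nondecreasing: both are divided by [1 + alpha], but [beta] first gains
   [alpha * mu_g]. *)
have be_th k : beta q 0 * theta q k <= beta q k.
  elim: k => [|k IH]; first by rewrite th0 mulr1.
  have [thE _ beE] := valid_parameters_rec q vq k.
  rewrite -(@ler_pM2l _ (1 + alpha q k)) ?addr_gt0 //.
  rewrite mulrCA -thE beE; apply: le_trans IH _.
  by rewrite lerDl mulr_ge0 // ltW.
set s := Num.sqrt (beta q 0); have s0 : 0 <= s by exact: sqrtr_ge0.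
have ss : s ^+ 2 = beta q 0 by rewrite sqr_sqrtr // ltW.
(* Square root of the step size condition after inserting [be_th]. *)
have al_ge k : s * theta q k <= alpha q k * L.
  rewrite -(@ler_pXn2r _ 2) ?nnegrE ?mulr_ge0 ?(ltW (al0 k)) ?(ltW (thpos k)) //.
  by rewrite !exprMn alL ss expr2 mulrA [leRHS]mulrC ler_pM2r.
elim=> [|k IH]; first by rewrite th0 mul1r mulr0 addr0.
have [thE _ _] := valid_parameters_rec q vq k.
(* Raising [k] by one costs [s * theta q k], which [al_ge] bounds by [alpha q k * L]. *)
rewrite -(@ler_pM2l _ (1 + alpha q k)) ?addr_gt0 // mulrA -thE -natr1.
have := al_ge k; lra.
Qed.

(* Here [beta] is constant, and [1 / sqrt (theta k)] grows by at least
   [sqrt mu_g / (2 * (L + sqrt mu_g))] at each step. *)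
Lemma sqrt_theta_le {R : realType} (q : parameters R) (L : R) :
  valid_parameters q -> 0 < mu_g q -> beta q 0 = mu_g q -> 0 <= L ->
  (forall k, alpha q k ^+ 2 * L ^+ 2 = theta q k * beta q k) ->
  forall k, Num.sqrt (theta q k)
    * (2 * (L + Num.sqrt (mu_g q)) + Num.sqrt (mu_g q) * k%:R)
    <= 2 * (L + Num.sqrt (mu_g q)).
Proof.
move=> vq mu0 be0 L0 alL; have [th0 _ _ al0 _] := vq.
have thpos := theta_gt0 q vq.
have beE k : beta q k = mu_g q.
  elim: k => [//|k IH]; have [_ _] := valid_parameters_rec q vq k.
  rewrite IH -[in RHS](mul1r (mu_g q)) mulrA mulr1 -mulrDl.
  by apply: mulfI; rewrite gt_eqF // addr_gt0.
set s := Num.sqrt (mu_g q); have s0 : 0 < s by rewrite sqrtr_gt0.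
have ss : s ^+ 2 = mu_g q by rewrite sqr_sqrtr // ltW.
have th_le1 k : theta q k <= 1.
  elim: k => [|k]; first by rewrite th0.
  have [-> _ _] := valid_parameters_rec q vq k; apply: le_trans.
  by rewrite ler_peMl ?lerDl ?ltW.
elim=> [|k IH]; first by rewrite th0 sqrtr1 mul1r mulr0 addr0.
have [thE _ _] := valid_parameters_rec q vq k.
set t := Num.sqrt (theta q k) in IH; set t' := Num.sqrt (theta q k.+1).
have t0 : 0 < t by rewrite sqrtr_gt0.
have t'0 : 0 < t' by rewrite sqrtr_gt0.
have tt : t ^+ 2 = theta q k by rewrite sqr_sqrtr // ltW.
have tt' : t' ^+ 2 = theta q k.+1 by rewrite sqr_sqrtr // ltW.
(* With [beta] constant the step size condition has an exact square root. *)
have alE : alpha q k * L = s * t.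
  have al_L : 0 <= alpha q k * L by rewrite mulr_ge0 // ltW.
  have s_t : 0 <= s * t by rewrite mulr_ge0 ?ltW.
  by apply/eqP; rewrite -(@eqrXn2 _ 2) // !exprMn alL beE ss tt mulrC.
have t1 : t <= 1 by rewrite -sqrtr1 ler_wsqrtr.
have t2 : t ^+ 2 = (1 + alpha q k) * t' ^+ 2 by rewrite tt tt' thE.
move: (alpha q k) (al0 k) alE t2 => a a0 alE t2.
rewrite -natr1; clearbody t t' s; clear - IH t0 t'0 a0 alE t2 t1 s0 L0.
have lt_t't : t' <= t.
  rewrite -(@ler_pXn2r _ 2) ?nnegrE ?(ltW t0) ?(ltW t'0) // t2.
  by rewrite ler_peMl ?sqr_ge0 // lerDl ltW.
have tt0 : 0 < t + t' by rewrite addr_gt0.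
(* Since [t ^+ 2 - t' ^+ 2 = a * t' ^+ 2], this reduces to [t * t' <= t + t'], true because
   [t' <= 1]. *)
have LD : L * (t - t') <= s * t'.
  rewrite -(ler_pM2r tt0).
  have -> : L * (t - t') * (t + t') = s * t' * (t * t').
    transitivity (L * (t ^+ 2 - t' ^+ 2)); first by ring.
    rewrite t2; transitivity (a * L * t' ^+ 2); first by ring.
    by rewrite alE; ring.
  rewrite ler_pM2l ?mulr_gt0 //; apply: le_trans (_ : _ <= t) _; last first.
    by rewrite lerDl ltW.
  by rewrite ler_piMr ?(ltW t0) // (le_trans lt_t't).
(* Divided by [t * t'], this bounds the growth [1 / t' - 1 / t] below by [s / (2 * (L + s))]. *)
have key : s * t * t' <= 2 * (L + s) * (t - t').
  rewrite -(ler_pM2r tt0) -alE.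
  have -> : 2 * (L + s) * (t - t') * (t + t') = 2 * (L + s) * (a * t' ^+ 2).
    transitivity (2 * (L + s) * (t ^+ 2 - t' ^+ 2)); first by ring.
    by rewrite t2; ring.
  have at0 : 0 <= a * t' by rewrite mulr_ge0 ?ltW.
  have st0 : 0 <= s * t' by rewrite mulr_ge0 ?ltW.
  have h : L * (t + t') <= 2 * (L + s) * t' by lra.
  by have := ler_wpM2l at0 h; lra.
rewrite -(ler_pM2l t0).
have := ler_wpM2l (ltW t'0) IH; have := key.
lra.
Qed.

Lemma theta_rate {R : realType} (q : parameters R) (L : R) :
  valid_parameters q -> 0 <= mu_g q -> (0 < mu_g q -> beta q 0 = mu_g q) ->
  0 <= L -> (forall k, alpha q k ^+ 2 * L ^+ 2 = theta q k * beta q k) ->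
  let Q := L + Num.sqrt (beta q 0) in
  forall k, theta q k <= Num.min (Q / (Q + Num.sqrt (beta q 0) * k%:R))
    (4 * Q ^+ 2 / (2 * Q + Num.sqrt (mu_g q) * k%:R) ^+ 2).
Proof.
move=> vq mu0 muE L0 alL Q k.
have [th0 _ be0 al0 _] := vq.
have thpos := theta_gt0 q vq k.
have th_lin := theta_le_linear q L vq mu0 L0 alL k.
have th_sqrt := sqrt_theta_le q L vq _ _ L0 alL k.
have s0 : 0 < Num.sqrt (beta q 0) by rewrite sqrtr_gt0.
have Q0 : 0 < Q by rewrite ltr_wpDl.
have sk0 : 0 <= Num.sqrt (beta q 0) * k%:R by rewrite mulr_ge0 ?(ltW s0).
have mk0 : 0 <= Num.sqrt (mu_g q) * k%:R by rewrite mulr_ge0 ?sqrtr_ge0.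
have th_le1 : theta q k <= 1.
  elim: k {thpos th_lin th_sqrt sk0 mk0} => [|k]; first by rewrite th0.
  have [-> _ _] := valid_parameters_rec q vq k; apply: le_trans.
  by rewrite ler_peMl ?lerDl ?ltW // theta_gt0.
have den1 : 0 < Q + Num.sqrt (beta q 0) * k%:R by lra.
have den2 : 0 < 2 * Q + Num.sqrt (mu_g q) * k%:R by lra.
rewrite le_min; apply/andP; split.
  rewrite ler_pdivlMr // /Q.
  (* Adding [theta <= 1], scaled by the square root of [beta q 0], replaces [L] by [Q] on both sides
     of the linear bound. *)
  have := ler_piMl (ltW s0) th_le1; lra.
rewrite ler_pdivlMr ?exprn_gt0 //.
have [mu_gt0|mu_le0] := ltP 0 (mu_g q).
  have h := th_sqrt mu_gt0 (muE mu_gt0).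
  rewrite -[theta q k]sqr_sqrtr ?(ltW thpos) // -exprMn.
  rewrite (_ : 4 * Q ^+ 2 = (2 * Q) ^+ 2); last by ring.
  rewrite ler_pXn2r ?nnegrE ?mulr_ge0 ?sqrtr_ge0 ?addr_ge0 ?mulr_ge0 ?(ltW Q0) //.
  by rewrite /Q (muE mu_gt0).
(* For [mu_g q = 0] the second bound degenerates to [theta q k <= 1]. *)
have -> : mu_g q = 0 by apply/eqP; rewrite eq_le mu_le0.
rewrite sqrtr0 mul0r addr0 (_ : 4 * Q ^+ 2 = (2 * Q) ^+ 2); last by ring.
by rewrite ler_piMl ?sqr_ge0.
Qed.

(** * Variational inequalities of the subproblems *)

Lemma is_argmin_penalty {R : realType} {n r} (h F : 'cV[R]_n -> \bar R)
    (C : set 'cV[R]_n) (M : 'M[R]_(r, n)) (a l : 'cV[R]_r) (zt x : 'cV[R]_n)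
    (K sigma c : R) :
  (forall z, h z != -oo%E) -> convex_efun h -> convex_set C ->
  0 <= sigma -> 0 <= c ->
  (forall z, C z -> F z = h z + (K + dot l (M *m z + a)
     + sigma / 2 * enorm (M *m z + a) ^+ 2 + c * enorm (z - zt) ^+ 2)%:E)%E ->
  is_argmin C F x <->
  [/\ C x, (h x < +oo)%E & forall z, C z ->
      (h x <= h z + (dot (M^T *m (l + sigma *: (M *m x + a))
                          + (2 * c) *: (x - zt)) (z - x))%:E)%E].
Proof.
move=> hN ch cC sigma0 c0 FE.
(* One shape for every subproblem: [sigma] is positive for the augmented step and zero for the
   implicit steps and the prox. It is prescribed on [C] only, the Lagrangian being infinite
   elsewhere. *)
set phi := fun z => K + dot l (M *m z + a)
   + sigma / 2 * enorm (M *m z + a) ^+ 2 + c * enorm (z - zt) ^+ 2.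
pose kappa d := sigma / 2 * dot (M *m d) (M *m d) + c * dot d d.
have -> : is_argmin C F x <-> is_argmin C (fun z => h z + (phi z)%:E)%E x.
  by split=> -[Cx Fx xmin]; split=> // [|z Cz]; rewrite -?FE // ?FE //;
    [rewrite -?FE //; exact: xmin|exact: xmin].
apply: (is_argmin_quadratic _ _ phi kappa) => //.
- move=> z; rewrite /phi /kappa !enorm_sqr.
  have -> : M *m z + a = (M *m x + a) + M *m (z - x).
    by rewrite mulmxBr; apply/colP => i; rewrite !mxE; ring.
  have -> : z - zt = (x - zt) + (z - x) by apply/colP => i; rewrite !mxE; ring.
  move: (x - zt) (M *m x + a) (z - x) => e u d.
  rewrite (dotDl d (_ *m _)) -dot_mulmx !dotE.
  by rewrite (dotC d e) (dotC (M *m d) u); lra.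
- by move=> t d; rewrite /kappa -scalemxAr !dotE; ring.
- by move=> d; rewrite /kappa addr_ge0 // mulr_ge0 ?dot_ge0 // divr_ge0.
Qed.

Definition eff_dom {R : realType} {m n r} (P : problem R m n r)
    (x : 'cV[R]_m) (y : 'cV[R]_n) : Prop :=
  [/\ csetX P x, csetY P y, (objf P x < +oo)%E & (objg P y < +oo)%E].

Lemma ereal_real {R : realType} (a : \bar R) :
  a != -oo%E -> (a < +oo)%E -> exists b, a = b%:E.
Proof. by case: a => // b; exists b. Qed.

Lemma eff_dom_lty {R : realType} {m n r} (P : problem R m n r) x y (c : R) :
  proper_efun (objf P) -> proper_efun (objg P) ->
  (objective P x y + delta_fun R (csetX P `*` csetY P) (x, y) + c%:E < +oo)%E
  -> eff_dom P x y.
Proof.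
move=> [fN _] [gN _]; rewrite /objective /delta_fun /eff_dom.
have := fN x; have := gN y; case: asboolP => [[/= Xx Yy]|_].
  by case: (objf P x) => [a||]; case: (objg P y) => [b||] // _ _ _; rewrite !ltry.
by case: (objf P x) => [a||]; case: (objg P y) => [b||].
Qed.

Lemma lagrangianE {R : realType} {m n r} (P : problem R m n r) x y l :
  csetX P x -> csetY P y ->
  (lagrangian P x y l = objf P x + objg P y + (dot l (residual P x y))%:E)%E.
Proof.
move=> Xx Yy; rewrite /lagrangian /objective /delta_fun.
by case: asboolP => [_|[]//]; rewrite adde0.
Qed.

Lemma aug_argmin_x {R : realType} {m n r} (P : problem R m n r) x y xt l
    (sigma c : R) :
  proper_closed_convex (objf P) -> convex_set (csetX P) ->
  csetY P y -> objg P y \is a fin_num -> 0 <= sigma -> 0 <= c ->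
  is_argmin (csetX P) (fun z => aug_lagrangian P sigma z y l
     + (c * enorm (z - xt)%R ^+ 2)%:E)%E x <->
  [/\ csetX P x, (objf P x < +oo)%E & forall z, csetX P z ->
     (objf P x <= objf P z + (dot ((matA P)^T *m (l + sigma *: residual P x y)
        + (2 * c) *: (x - xt)) (z - x))%:E)%E].
Proof.
move=> [[fN _] _ cf] cX Yy /fineK gy sigma0 c0.
rewrite /residual -addrA.
apply: (is_argmin_penalty _ _ _ _ _ _ _ _ (fine (objg P y))) => // z Xz.
rewrite /aug_lagrangian lagrangianE // -gy /residual -(addrA (matA P *m z)).
by rewrite !EFinD !addeA.
Qed.

Lemma argmin_x {R : realType} {m n r} (P : problem R m n r) x y xt l (c : R) :
  proper_closed_convex (objf P) -> convex_set (csetX P) ->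
  csetY P y -> objg P y \is a fin_num -> 0 <= c ->
  is_argmin (csetX P) (fun z => lagrangian P z y l
     + (c * enorm (z - xt)%R ^+ 2)%:E)%E x <->
  [/\ csetX P x, (objf P x < +oo)%E & forall z, csetX P z ->
     (objf P x <= objf P z
        + (dot ((matA P)^T *m l + (2 * c) *: (x - xt)) (z - x))%:E)%E].
Proof.
move=> pf cX Yy gy c0.
have := aug_argmin_x P x y xt l 0 c pf cX Yy gy (lexx 0) c0.
rewrite scale0r addr0 /aug_lagrangian.
suff -> : (fun z => lagrangian P z y l + (c * enorm (z - xt) ^+ 2)%:E)%E =
  (fun z => lagrangian P z y l + (0 / 2 * enorm (residual P z y) ^+ 2)%:E
     + (c * enorm (z - xt) ^+ 2)%:E)%E by [].
by apply/funext => z; rewrite !mul0r adde0.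
Qed.

Lemma argmin_y {R : realType} {m n r} (P : problem R m n r) x y yt l (c : R) :
  proper_closed_convex (objg P) -> convex_set (csetY P) ->
  csetX P x -> objf P x \is a fin_num -> 0 <= c ->
  is_argmin (csetY P) (fun z => lagrangian P x z l
     + (c * enorm (z - yt)%R ^+ 2)%:E)%E y <->
  [/\ csetY P y, (objg P y < +oo)%E & forall z, csetY P z ->
     (objg P y <= objg P z
        + (dot ((matB P)^T *m l + (2 * c) *: (y - yt)) (z - y))%:E)%E].
Proof.
move=> [[gN _] _ cg] cY Xx /fineK fx c0.
rewrite -[in X in _ <-> X](addr0 l) -(scale0r (matB P *m y + (matA P *m x - vecb P))).
apply: (is_argmin_penalty _ _ _ _ _ _ _ _ (fine (objf P x))) => // z Yz.
rewrite lagrangianE // -fx (_ : residual P x z = matB P *m z + (matA P *m x - vecb P)).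
  by rewrite mul0r mul0r addr0 !EFinD !addeA (addeC (objg P z)).
by rewrite /residual addrAC addrC.
Qed.

(** Completing the square: the shift of the prox center accounts for the linear term of the
    Lagrangian, so the condition obtained is that of [argmin_y]. *)
Lemma is_proxE {R : realType} {m n r} (P : problem R m n r) y yt l (c : R) :
  proper_closed_convex (objg P) -> convex_set (csetY P) -> 0 < c ->
  is_prox (csetY P) (2 * c)^-1 (objg P) (yt - (2 * c)^-1 *: ((matB P)^T *m l)) y
  <->
  [/\ csetY P y, (objg P y < +oo)%E & forall z, csetY P z ->
     (objg P y <= objg P z
        + (dot ((matB P)^T *m l + (2 * c) *: (y - yt)) (z - y))%:E)%E].
Proof.
move=> [[gN _] _ cg] cY c0.
have -> : (matB P)^T *m l + (2 * c) *: (y - yt) = (matB P)^T *m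
    (0 + 0 *: (matB P *m y + 0))
    + (2 * c) *: (y - (yt - (2 * c)^-1 *: ((matB P)^T *m l))).
  rewrite scale0r addr0 mulmx0 add0r opprB addrA addrAC.
  by rewrite addrC [in RHS]scalerDr scalerA mulfV ?scale1r // gt_eqF // mulr_gt0.
apply: (is_argmin_penalty _ _ _ _ _ _ _ _ 0) => //; first exact: ltW.
move=> z Yz; rewrite dotC dot0r !mul0r !add0r.
by have -> : 1 / (2 * (2 * c)^-1) = c by field; rewrite gt_eqF.
Qed.

(** * Equivalence of the scheme and the algorithm *)

Lemma lbar_lhat {R : realType} {m n r} (P : problem R m n r)
    (q : parameters R) (s : iterates R m n r) k :
  valid_parameters q ->
  vk s k.+1 = xk s k.+1 + (alpha q k)^-1 *: (xk s k.+1 - xk s k) ->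
  lam s k + (alpha q k / theta q k) *: residual P (vk s k.+1) (wk s k)
  = lhat P q s k + (1 / theta q k.+1) *: residual P (xk s k.+1) (yk s k).
Proof.
move=> vq ->; have [thE _ _] := valid_parameters_rec q vq k.
have [_ _ _ al0 _] := vq; have th0 := theta_gt0 q vq k.+1.
rewrite /lhat /residual thE !(mulmxDr, mulmxBr, mulmxN) -!scalemxAr !mulmxBr.
(* On the left, [xk s k.+1] enters with the factor [(1 + alpha q k) / theta q k], which is
   [1 / theta q k.+1]: hence the penalty parameter. *)
apply/colP => i; rewrite !mxE; field.
by rewrite !gt_eqF // addr_gt0.
Qed.

(** [is_argmin] requires a value below [+oo], and the [x] step evaluates the Lagrangian at
    [yk s k.+1], so one subproblem controls both blocks. *)
Lemma scheme_eff_dom {R : realType} {m n r} (P : problem R m n r)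
    (q : parameters R) (s : iterates R m n r) k :
  proper_efun (objf P) -> proper_efun (objg P) -> scheme_G P q s ->
  eff_dom P (xk s k.+1) (yk s k.+1).
Proof.
move=> pf pg /(_ k)[_ [_ + _] _ _ _].
by rewrite -addeA -EFinD; apply: eff_dom_lty.
Qed.

(** The first subproblem of the algorithm evaluates [objg] at [yk s 0], so its finite value forces
    the two conditions on that point; the scheme uses it only as a point of the space. *)
Lemma scheme_algorithm {R : realType} {m n r} (P : problem R m n r)
    (q : parameters R) (s : iterates R m n r) :
  convex_set (csetX P) -> convex_set (csetY P) ->
  proper_closed_convex (objf P) -> proper_closed_convex (objg P) ->
  valid_parameters q -> 0 <= mu_f q -> 0 <= mu_g q ->
  csetY P (yk s 0) /\ (objg P (yk s 0) < +oo)%E /\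
     scheme_G P q s /\ lbar_choice P q s
  <-> algorithm P q s.
Proof.
move=> cX cY pf pg vq muf0 mug0.
have [pef _ _] := pf; have [peg _ _] := pg.
have [_ _ _ al0 _] := vq.
have etaf0 k : 0 < eta_f q k.
  by rewrite ltr_wpDr ?mulr_gt0 ?addr_gt0 ?gamma_gt0 // mulr_ge0 // ltW.
have etag0 k : 0 < eta_g q k.
  by rewrite ltr_wpDr ?mulr_gt0 ?addr_gt0 ?beta_gt0 // mulr_ge0 // ltW.
have cf0 k : 0 < eta_f q k / (2 * alpha q k ^+ 2).
  by rewrite divr_gt0 ?mulr_gt0 ?exprn_gt0.
have cg0 k : 0 < eta_g q k / (2 * alpha q k ^+ 2).
  by rewrite divr_gt0 ?mulr_gt0 ?exprn_gt0.
have sig0 k : 0 <= 1 / theta q k.+1 by rewrite div1r invr_ge0 ltW // theta_gt0.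
have tauE k : alpha q k ^+ 2 / eta_g q k
    = (2 * (eta_g q k / (2 * alpha q k ^+ 2)))^-1.
  by field; rewrite !gt_eqF.
have fin_g y : (objg P y < +oo)%E -> objg P y \is a fin_num.
  by move=> gy; rewrite fin_numE peg.1 -ltey.
have fin_f x : (objf P x < +oo)%E -> objf P x \is a fin_num.
  by move=> fx; rewrite fin_numE pef.1 -ltey.
split=> [[Y0 [g0 [sG lc]]] k|alg].
  have dom k' := scheme_eff_dom P q s k' pef peg sG.
  have [Yk gk] : csetY P (yk s k) /\ (objg P (yk s k) < +oo)%E.
    by case: k => // k; have [] := dom k.
  have [vE xmin lE ymin wE] := sG k.
  have [Xk' Yk' fk' gk'] := dom k.
  have xVI := argmin_x P _ _ (xtilde q s k) (lbar s k.+1) _ pf cX Yk'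
    (fin_g _ gk') (ltW (cf0 k)).
  rewrite /= tauE; split; last do 2! [split=> //]; last split; last by split.
    apply/(aug_argmin_x _ _ _ _ _ _ _ pf cX Yk (fin_g _ gk) (sig0 k) (ltW (cf0 k))).
    rewrite -(lbar_lhat P q s k vq vE) -lc; exact/xVI.
  apply/(is_proxE _ _ _ _ _ pg cY (cg0 k)).
  exact/(argmin_y _ _ _ _ _ _ pg cY Xk' (fin_f _ fk') (ltW (cg0 k))).
have dom_x k : eff_dom P (xk s k.+1) (yk s k).
  have [[_ + _] _] := alg k.
  by rewrite /aug_lagrangian -addeA -EFinD /lagrangian -addeA -EFinD; apply: eff_dom_lty.
have dom_y k : csetY P (yk s k.+1) /\ (objg P (yk s k.+1) < +oo)%E.
  by have [_ Yk _ gk] := dom_x k.+1.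
have [_ Y0 _ g0] := dom_x 0; do 2! [split=> //]; split; last first.
  by move=> k; have [_ [_ [-> _]]] := alg k.
move=> k; have [xmin [vE [lb [+ [wE lE]]]]] := alg k; rewrite tauE => ymin.
have [Xk' Yk fk' gk] := dom_x k; have [Yk' gk'] := dom_y k.
split=> //.
  apply/(argmin_x _ _ _ _ _ _ pf cX Yk' (fin_g _ gk') (ltW (cf0 k))).
  move/(aug_argmin_x _ _ _ _ _ _ _ pf cX Yk (fin_g _ gk) (sig0 k) (ltW (cf0 k))): xmin.
  by rewrite -(lbar_lhat P q s k vq vE) -lb.
apply/(argmin_y _ _ _ _ _ _ pg cY Xk' (fin_f _ fk') (ltW (cg0 k))).
exact/(is_proxE _ _ _ _ _ pg cY (cg0 k)).
Qed.

(** * Subgradients, duality gap and the real Lyapunov function *)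

Lemma strongly_convex_vi {R : realType} {n} (mu : R) (C : set 'cV[R]_n)
    (h : 'cV[R]_n -> \bar R) (x g : 'cV[R]_n) :
  (forall z, h z != -oo%E) -> strongly_convex_on mu C h ->
  C x -> (h x < +oo)%E ->
  (forall z, C z -> (h x <= h z + (dot g (z - x))%:E)%E) ->
  forall z, C z -> (h z < +oo)%E ->
  mu / 2 * dot (z - x) (z - x)
    <= fine (h z) - fine (h x) - dot (- g) (z - x).
Proof.
move=> hN sc Cx hx vi z Cz hz.
have [a ha] := ereal_real _ (hN x) hx.
have [b hb] := ereal_real _ (hN z) hz.
rewrite -lee_fin -enorm_sqr ha hb !EFinB -ha -hb; apply: sc => //.
(* The variational inequality makes [- g] a subgradient of [h + delta_fun C] at [x]; outside [C] the
   right-hand side is infinite. *)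
rewrite /subdiff /= /delta_fun; case: asboolP => // _; rewrite adde0 ha.
split=> // u; case: asboolP => [Cu|_].
  rewrite adde0; have := vi u Cu; rewrite ha; have := hN u.
  case: (h u) => [c||] // _; last by move=> _; rewrite leey.
  by rewrite -!EFinD !lee_fin dotNl; lra.
by have := hN u; case: (h u) => [c||] // _; rewrite leey.
Qed.

(** Real value of L(x, y, ls) - L(xs, ys, l); [l] disappears because the residual vanishes at a
    saddle point. *)
Definition gap {R : realType} {m n r} (P : problem R m n r)
    (xs : 'cV[R]_m) (ys : 'cV[R]_n) (ls : 'cV[R]_r) x y : R :=
  fine (objf P x) + fine (objg P y) - (fine (objf P xs) + fine (objg P ys))
  + dot ls (residual P x y).

(* The real value of [lyapunov], meaningful only when [(x_k, y_k)] is in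
   [eff_dom]: elsewhere [fine] sends the infinite values to [0]. *)
Definition lyap {R : realType} {m n r} (P : problem R m n r)
    (q : parameters R) (s : iterates R m n r) xs ys ls k : R :=
  gap P xs ys ls (xk s k) (yk s k)
  + gamma q k / 2 * dot (vk s k - xs) (vk s k - xs)
  + beta q k / 2 * dot (wk s k - ys) (wk s k - ys)
  + theta q k / 2 * dot (lam s k - ls) (lam s k - ls).

Lemma eff_dom_objective {R : realType} {m n r} (P : problem R m n r) x y :
  proper_efun (objf P) -> proper_efun (objg P) -> eff_dom P x y ->
  (objf P x = (fine (objf P x))%:E)%E /\ (objg P y = (fine (objg P y))%:E)%E.
Proof.
move=> [fN _] [gN _] [_ _ fx gy].
by split; rewrite fineK // fin_numE ?fN ?gN -ltey.
Qed.

Lemma lagrangian_pinfty {R : realType} {m n r} (P : problem R m n r) x y l :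
  proper_efun (objf P) -> proper_efun (objg P) ->
  ~ eff_dom P x y -> lagrangian P x y l = +oo%E.
Proof.
move=> pf pg nd; apply/eqP; rewrite -leye_eq leNgt; apply/negP => lt.
by apply: nd; apply: eff_dom_lty lt.
Qed.

Lemma saddleP {R : realType} {m n r} (P : problem R m n r) xs ys ls :
  proper_efun (objf P) -> proper_efun (objg P) -> is_saddle P xs ys ls ->
  [/\ eff_dom P xs ys, residual P xs ys = 0 &
      forall x y, eff_dom P x y -> 0 <= gap P xs ys ls x y].
Proof.
move=> pf pg [Xs Ys fin sad].
have ds : eff_dom P xs ys.
  by apply: (eff_dom_lty _ _ _ (dot ls (residual P xs ys))) => //;
    rewrite ltey; move: fin; rewrite fin_numE => /andP[].
have [fE gE] := eff_dom_objective _ _ _ pf pg ds.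
have res0 : residual P xs ys = 0.
  apply: dot_eq0; apply/eqP; rewrite eq_le dot_ge0 andbT.
  (* Shifting the multiplier by the residual itself makes the squared residual nonpositive. *)
  have [+ _] := sad xs ys (ls + residual P xs ys).
  by rewrite !lagrangianE // fE gE -!EFinD lee_fin dotDl; lra.
split=> // x y dxy; have [_ +] := sad x y ls.
have [fE' gE'] := eff_dom_objective _ _ _ pf pg dxy; have [Xx Yy _ _] := dxy.
rewrite !lagrangianE // fE gE fE' gE' -!EFinD lee_fin res0 dot0r /gap; lra.
Qed.

Lemma lagrangian_gap {R : realType} {m n r} (P : problem R m n r)
    xs ys ls l x y :
  proper_efun (objf P) -> proper_efun (objg P) ->
  eff_dom P xs ys -> residual P xs ys = 0 -> eff_dom P x y ->
  (lagrangian P x y ls - lagrangian P xs ys l = (gap P xs ys ls x y)%:E)%E.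
Proof.
move=> pf pg ds res0 d; have [Xs Ys _ _] := ds; have [Xx Yy _ _] := d.
have [fE gE] := eff_dom_objective _ _ _ pf pg ds.
have [fE' gE'] := eff_dom_objective _ _ _ pf pg d.
rewrite !lagrangianE // fE gE fE' gE' -!EFinD res0 dot0r /gap.
by congr EFin; ring.
Qed.

Lemma lyapunovE {R : realType} {m n r} (P : problem R m n r)
    (q : parameters R) (s : iterates R m n r) xs ys ls k :
  proper_efun (objf P) -> proper_efun (objg P) ->
  eff_dom P xs ys -> residual P xs ys = 0 -> eff_dom P (xk s k) (yk s k) ->
  lyapunov P q s xs ys ls k = (lyap P q s xs ys ls k)%:E.
Proof.
by move=> pf pg ds res0 d; rewrite /lyapunov lagrangian_gap // !enorm_sqr -!EFinD.
Qed.

Lemma lyapunov_pinfty {R : realType} {m n r} (P : problem R m n r)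
    (q : parameters R) (s : iterates R m n r) xs ys ls k :
  proper_efun (objf P) -> proper_efun (objg P) ->
  eff_dom P xs ys -> ~ eff_dom P (xk s k) (yk s k) ->
  lyapunov P q s xs ys ls k = +oo%E.
Proof.
move=> pf pg ds nd; rewrite /lyapunov lagrangian_pinfty //.
have [Xs Ys _ _] := ds; have [fE gE] := eff_dom_objective _ _ _ pf pg ds.
by rewrite lagrangianE // fE gE.
Qed.

Lemma lyap_ge {R : realType} {m n r} (P : problem R m n r)
    (q : parameters R) (s : iterates R m n r) xs ys ls k :
  0 < gamma q k -> 0 < beta q k ->
  gap P xs ys ls (xk s k) (yk s k)
    + theta q k / 2 * dot (lam s k - ls) (lam s k - ls)
  <= lyap P q s xs ys ls k.
Proof.
move=> ga0 be0; rewrite /lyap.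
have := mulr_ge0 (ltW ga0) (dot_ge0 (vk s k - xs)).
have := mulr_ge0 (ltW be0) (dot_ge0 (wk s k - ys)).
by rewrite -subr_ge0 => *; lra.
Qed.

(** [eta] and the extrapolated point are designed so that the gradient of the proximal term splits
    into the two parts that [block_descent] expects in [p]. *)
Lemma proximal_gradient {R : realType} {n} (x xo v vo : 'cV[R]_n)
    (al ga mu eta : R) :
  0 < al -> eta = (al + 1) * ga + mu * al -> 0 < eta ->
  v = x + al^-1 *: (x - xo) ->
  (2 * (eta / (2 * al ^+ 2))) *: (x - (xo + (al * ga / eta) *: (vo - xo)))
  = (ga / al) *: (v - vo) + mu *: (v - x).
Proof.
move=> al0 etaE eta0 ->; rewrite etaE in eta0 *.
by apply/colP => i; rewrite !mxE; field; rewrite !gt_eqF.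
Qed.

Lemma lyap_step {R : realType} {m n r} (P : problem R m n r)
    (q : parameters R) (s : iterates R m n r) xs ys ls k :
  convex_set (csetX P) -> convex_set (csetY P) ->
  proper_closed_convex (objf P) -> proper_closed_convex (objg P) ->
  is_saddle P xs ys ls ->
  valid_parameters q -> 0 <= mu_f q -> 0 <= mu_g q ->
  strongly_convex_on (mu_f q) (csetX P) (objf P) ->
  strongly_convex_on (mu_g q) (csetY P) (objg P) ->
  alpha q k ^+ 2 * opnorm (matB P) ^+ 2 = theta q k * beta q k ->
  scheme_G P q s -> lbar_choice P q s -> eff_dom P (xk s k) (yk s k) ->
  eff_dom P (xk s k.+1) (yk s k.+1) ->
  (1 + alpha q k) * lyap P q s xs ys ls k.+1 <= lyap P q s xs ys ls k.
Proof.
move=> cX cY pf pg sad vq muf0 mug0 scf scg alB sG lc d d'.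
have [pef _ _] := pf; have [peg _ _] := pg.
have [_ _ _ al0 _] := vq.
have ga0 := gamma_gt0 q vq muf0 k; have be0 := beta_gt0 q vq mug0 k.
have etaf0 : 0 < eta_f q k.
  by rewrite ltr_wpDr ?mulr_gt0 ?addr_gt0 // mulr_ge0 // ltW.
have etag0 : 0 < eta_g q k.
  by rewrite ltr_wpDr ?mulr_gt0 ?addr_gt0 // mulr_ge0 // ltW.
have cf0 : 0 <= eta_f q k / (2 * alpha q k ^+ 2).
  by rewrite divr_ge0 ?mulr_ge0 ?exprn_ge0 ?ltW.
have cg0 : 0 <= eta_g q k / (2 * alpha q k ^+ 2).
  by rewrite divr_ge0 ?mulr_ge0 ?exprn_ge0 ?ltW.
have [ds res0 gap0] := saddleP _ _ _ _ pef peg sad.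
have [fE gE] := eff_dom_objective _ _ _ pef peg d'.
have fin_f : objf P (xk s k.+1) \is a fin_num by rewrite fE.
have fin_g : objg P (yk s k.+1) \is a fin_num by rewrite gE.
have [Xs Ys fs gs] := ds; have [Xk Yk fk gk] := d.
have [Xk' Yk' fk' gk'] := d'.
have [vE /(argmin_x _ _ _ _ _ _ pf cX Yk' fin_g cf0)[_ _ vix] lE
  /(argmin_y _ _ _ _ _ _ pg cY Xk' fin_f cg0)[_ _ viy] wE] := sG k.
rewrite (proximal_gradient _ _ _ _ _ _ _ _ (al0 k) erefl etaf0 vE) in vix.
rewrite (proximal_gradient _ _ _ _ _ _ _ _ (al0 k) erefl etag0 wE) in viy.
have {vix}hf := strongly_convex_vi _ _ _ _ _ pef.1 scf Xk' fk' vix.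
have {viy}hg := strongly_convex_vi _ _ _ _ _ peg.1 scg Yk' gk' viy.
move: hf hg; rewrite !opprD !addrA => hf hg.
(* At the previous iterate plain convexity suffices, so the quadratic term is discarded. *)
have hf0 := le_trans (mulr_ge0 (divr_ge0 muf0 (ler0n _ 2)) (dot_ge0 _)) (hf _ Xk fk).
have hg0 := le_trans (mulr_ge0 (divr_ge0 mug0 (ler0n _ 2)) (dot_ge0 _)) (hg _ Yk gk).
have := lyapunov_step _ _ _ _ _ _ ls _ _ _ _ _ _ _ _ _ _ _ _ 
  _ _ _ _ _ _ _ _ _ _ (al0 k) (theta_gt0 q vq k)
  ga0 muf0 mug0 alB res0 vE wE lE (lc k)
  (hf _ Xs fs) hf0 (hg _ Ys gs) hg0.
(* The recursions turn the weights of [lyapunov_step] into [1 + alpha q k] times those of index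
   [k.+1]. *)
have [thE gaE beE] := valid_parameters_rec q vq k.
rewrite -gaE -beE {1}thE /lyap /gap /residual; lra.
Qed.

(* [lam k - (theta k)^-1 *: residual] is constant along the scheme. *)
Lemma residualE {R : realType} {m n r} (P : problem R m n r)
    (q : parameters R) (s : iterates R m n r) :
  valid_parameters q -> scheme_G P q s -> forall k,
  residual P (xk s k) (yk s k)
    = theta q k *: (lam s k - lam s 0 + residual P (xk s 0) (yk s 0)).
Proof.
move=> vq sG; have [th0 _ _ al0 _] := vq.
elim=> [|k IH]; first by rewrite th0 subrr add0r scale1r.
have [thE _ _] := valid_parameters_rec q vq k.
have [vE _ lE _ wE] := sG k.
have al1 : 0 < 1 + alpha q k by rewrite addr_gt0.
have := residual_step (matA P) (matB P) (vecb P) _ _ _ _ _ _ _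
  (gt_eqF (al0 k)) vE wE.
rewrite -!/(residual P _ _) IH => /eqP; rewrite subr_eq => /eqP stepE.
(* The residual and [lam] are driven by the same vector, the residual at [(vk, wk)], and the
   recursion of [theta] matches the factors. *)
apply: (scalerI (a := 1 + alpha q k)); rewrite ?gt_eqF // stepE scalerA -thE lE.
apply/colP => i; rewrite !mxE; field.
by rewrite gt_eqF // theta_gt0.
Qed.

(** * Assembly: from the decrease of the energy to the convergence rates *)

Theorem theorem3p1 (R : realType) (m n r : nat) (P : problem R m n r)
    (q : parameters R) (s : iterates R m n r)
    (xs : 'cV[R]_m) (ys : 'cV[R]_n) (ls : 'cV[R]_r)
    (closedX : closed (csetX P)) (convexX : convex_set (csetX P))
    (closedY : closed (csetY P)) (convexY : convex_set (csetY P))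
    (pccf : proper_closed_convex (objf P))
    (pccg : proper_closed_convex (objg P))
    (saddle : is_saddle P xs ys ls)
    (validq : valid_parameters q)
    (muf_ge0 : 0 <= mu_f q) (mug_ge0 : 0 <= mu_g q) :
  (csetY P (yk s 0) /\ (objg P (yk s 0) < +oo)%E /\
     scheme_G P q s /\ lbar_choice P q s
   <-> algorithm P q s)
  /\
  (strongly_convex_on (mu_f q) (csetX P) (objf P) ->
   strongly_convex_on (mu_g q) (csetY P) (objg P) ->
   (0 < mu_f q -> gamma q 0 = mu_f q) ->
   (0 < mu_g q -> beta q 0 = mu_g q) ->
   (forall k, alpha q k ^+ 2 * opnorm (matB P) ^+ 2 = theta q k * beta q k) ->
   scheme_G P q s -> lbar_choice P q s ->
   let E := lyapunov P q s xs ys ls in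
   let R0 := calR0 P q s xs ys ls in
   let Q := opnorm (matB P) + Num.sqrt (beta q 0) in
   [/\ (forall k, (E k.+1 - E k <= - ((alpha q k)%:E * E k.+1))%E),
       (forall k, (0 < k)%N -> csetX P (xk s k) /\ csetY P (yk s k)) &
       forall k,
         [/\ ((enorm (residual P (xk s k) (yk s k)))%:E
                <= (theta q k)%:E * R0)%E,
             (lagrangian P (xk s k) (yk s k) ls - lagrangian P xs ys (lam s k)
                <= (theta q k)%:E * E 0%N)%E,
             (`| objective P (xk s k) (yk s k) - objective P xs ys |
                <= (theta q k)%:E * (E 0%N + (enorm ls)%:E * R0))%E &
             theta q k <= Num.min
               (Q / (Q + Num.sqrt (beta q 0) * k%:R))
               (4 * Q ^+ 2 / (2 * Q + Num.sqrt (mu_g q) * k%:R) ^+ 2)]]).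
Proof.
split; first exact: scheme_algorithm.
move=> scf scg gaE beE alB sG lc E R0 Q.
have [pef _ _] := pccf; have [peg _ _] := pccg.
have [th0 _ _ al0 _] := validq.
have thpos := theta_gt0 q validq.
have [ds res0 gap0] := saddleP _ _ _ _ pef peg saddle.
have dom k := scheme_eff_dom P q s k pef peg sG.
have EE k : eff_dom P (xk s k) (yk s k) -> E k = (lyap P q s xs ys ls k)%:E.
  exact: lyapunovE.
have step k : eff_dom P (xk s k) (yk s k) ->
    (1 + alpha q k) * lyap P q s xs ys ls k.+1 <= lyap P q s xs ys ls k.
  by move=> d; apply: lyap_step.
split.
- move=> k; rewrite (EE k.+1 (dom k)).
  have [d|nd] := pselect (eff_dom P (xk s k) (yk s k)).
    by rewrite EE // -EFinM -EFinN -EFinB lee_fin; have := step k d; lra.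
  (* Possible only for [k = 0]: then [E k] is [+oo] and the left-hand side is [-oo]. *)
  by rewrite /E lyapunov_pinfty // leNye.
- by case=> // k _; have [] := dom k.
move=> k; have rate := theta_rate q _ validq mug_ge0 beE (opnorm_ge0 _) alB k.
have [d0|nd] := pselect (eff_dom P (xk s 0) (yk s 0)); last first.
  (* From an initial point outside the domain, the three bounds involving [E 0] or [R0] have
     right-hand side [+oo]. *)
  have E0 : E 0 = +oo%E by exact: lyapunov_pinfty.
  have R0E : R0 = +oo%E.
    by rewrite /R0 /calR0 -/E E0 gt0_muley ?lte_fin.
  have ooE : (E 0%N + (enorm ls)%:E * R0 = +oo)%E.
    rewrite E0 R0E addye // -ltNye; apply: lt_le_trans (ltNyr 0) _.
    by rewrite mule_ge0 ?lee_fin ?enorm_ge0 ?leey.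
  have thoo : ((theta q k)%:E * +oo = +oo)%E by rewrite gt0_muley ?lte_fin.
  by rewrite ooE R0E E0 thoo; split=> //; exact: leey.
have d k' : eff_dom P (xk s k') (yk s k') by case: k'.
have lyap_le k' : lyap P q s xs ys ls k' <= theta q k' * lyap P q s xs ys ls 0.
  elim: k' => [|k' IH]; first by rewrite th0 mul1r.
  have [thE _ _] := valid_parameters_rec q validq k'.
  rewrite -(@ler_pM2l _ (1 + alpha q k')) ?addr_gt0 // mulrA -thE.
  exact: le_trans (step k' (d k')) IH.
have ga0 := gamma_gt0 q validq muf_ge0; have be0 := beta_gt0 q validq mug_ge0.
have lge k' := lyap_ge P q s xs ys ls k' (ga0 k') (be0 k').
have gap_ge0 k' := gap0 _ _ (d k').
set e0 := lyap P q s xs ys ls 0 in lyap_le.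
pose r0 := Num.sqrt (2 * e0) + enorm (lam s 0 - ls)
  + enorm (residual P (xk s 0) (yk s 0)).
have R0E : R0 = r0%:E by rewrite /R0 /calR0 -/E EE // -EFinM -!EFinD.
have r00 : 0 <= r0 by rewrite !addr_ge0 ?enorm_ge0 ?sqrtr_ge0.
(* The multiplier term of the energy has weight [theta q k / 2] and the energy is at most
   [theta q k * e0], so [theta q k] cancels and the bound is uniform in [k]. *)
have lam_le : enorm (lam s k - ls) <= Num.sqrt (2 * e0).
  rewrite ler_sqrt; last first.
    have := lge 0; rewrite -/e0 th0; have := gap_ge0 0.
    by have := dot_ge0 (lam s 0 - ls); lra.
  rewrite -(ler_pM2l (thpos k)).
  by have := lge k; have := gap_ge0 k; have := lyap_le k; lra.
have res_le : enorm (residual P (xk s k) (yk s k)) <= theta q k * r0.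
  rewrite (residualE P q s validq sG) enormZ gtr0_norm // ler_pM2l //.
  apply: le_trans (enormD _ _) _; rewrite lerD2r.
  have -> : lam s k - lam s 0 = (lam s k - ls) - (lam s 0 - ls).
    by apply/colP => i; rewrite !mxE; ring.
  by apply: le_trans (enormD _ _) _; rewrite enormN lerD2r.
have gap_le : gap P xs ys ls (xk s k) (yk s k) <= theta q k * e0.
  have := lge k; have := lyap_le k.
  have := mulr_ge0 (ltW (thpos k)) (dot_ge0 (lam s k - ls)); lra.
rewrite R0E EE // -/e0 -!EFinM lagrangian_gap // !lee_fin.
split=> //.
have [fE gE] := eff_dom_objective _ _ _ pef peg (d k).
have [fsE gsE] := eff_dom_objective _ _ _ pef peg ds.
rewrite /objective fE gE fsE gsE -!EFinD lee_fin.
(* The objective difference is the gap, between 0 and [theta q k * e0], minus the product of [ls]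
   with the residual. *)
have := normr_dot_le ls (residual P (xk s k) (yk s k)).
have := ler_wpM2l (enorm_ge0 ls) res_le.
have := gap_ge0 k; move: gap_le; rewrite /gap => h1 h2 h3 /ler_normlP[h4 h5].
by rewrite ler_norml; apply/andP; split; lra.
Qed.
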